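(* For every integer $n\geq 3$, the generalized $3$-connectivity of the $(n,2)$-bubble-sort graph $B_{n,2}$ satisfies $\kappa_{3}(B_{n,2})=n-2$.
   Context: For positive integers $n>k$, let $[n]=\{1,\dots,n\}$ and let $P_{n,k}$ be the set of arrangements of $k$ elements of $[n]$, i.e. sequences $a_1a_2\cdots a_k$ of $k$ pairwise distinct elements of $[n]$. The $(n,k)$-bubble-sort graph $B_{n,k}$ is the simple undirected graph with vertex set $P_{n,k}$ in which two vertices $u=a_1a_2\cdots a_k$ and $v=b_1b_2\cdots b_k$ are adjacent if and only if one of the following holds: (a) there exists an integer $m\in[2,k]$ such that $a_{m-1}=b_m$, $a_m=b_{m-1}$ and $a_i=b_i$ for all $i\in[k]\setminus\{m-1,m\}$; (b) $a_i=b_i$ for all $i\in[k]\setminus\{1\}$ and $a_1\neq b_1$. For a graph $G$ and $S\subseteq V(G)$, $\kappa_G(S)$ denotes the maximum number $r$ of edge-disjoint trees $T_1,\dots,T_r$ in $G$, each connecting $S$ (i.e. $S\subseteq V(T_i)$), such that $V(T_i)\cap V(T_j)=S$ for all distinct $i,j\in\{1,\dots,r\}$. The generalized $3$-connectivity of $G$ is $\kappa_3(G)=\min\{\kappa_G(S) : S\subseteq V(G),\ |S|=3\}$. *)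

(* Defs.v *)
From mathcomp Require Import all_boot.
Set Implicit Arguments.
Unset Strict Implicit.
Unset Printing Implicit Defensive.

Record sgraph := SGraph {
  vertex :> finType;
  adj : rel vertex;
  adj_sym : symmetric adj;
  adj_irr : irreflexive adj }.

Definition edges (G : sgraph) : {set {set G}} :=
  [set [set p.1; p.2] | p : G * G & adj p.1 p.2].

(* A pair (vertex set, edge set), where an edge is the two-element set of its
   endpoints; [is_subgraph] says which pairs are subgraphs of G. *)
Definition subgraph (G : sgraph) : finType := ({set G} * {set {set G}})%type.

Section Subgraphs.
Variable G : sgraph.
Implicit Types (S : {set G}) (T : subgraph G) (F : {set subgraph G}).

Definition VG T : {set G} := T.1.
Definition EG T : {set {set G}} := T.2.

Definition is_subgraph T : bool :=
  (EG T \subset edges G) && [forall e in EG T, e \subset VG T].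

Definition subadj T : rel G := [rel x y | [set x; y] \in EG T].

Definition connected T : bool :=
  (VG T != set0) &&
  [forall x in VG T, forall y in VG T, connect (subadj T) x y].

(* A cycle is a cyclic sequence of at least three distinct vertices; it has
   length at most #|G|, which makes the quantifier bounded: see acyclicP. *)
Definition acyclic T : bool :=
  [forall m : 'I_#|G|.+1, forall c : m.-tuple G,
     ucycleb (subadj T) c ==> (m <= 2)].

Lemma acyclicP T :
  reflect (forall c : seq G, ucycle (subadj T) c -> size c <= 2) (acyclic T).
Proof.
apply: (iffP forallP) => [acT c cyc | acT m].
  have szc : size c < #|G|.+1.
    by rewrite ltnS -(card_uniqP (ucycle_uniq cyc)) max_card.
  have /forallP/(_ (in_tuple c))/implyP := acT (Ordinal szc).
  by move=> H; apply: H; exact: cyc.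
apply/forallP => c; apply/implyP => cyc.
by have := acT _ cyc; rewrite size_tuple.
Qed.

Definition is_tree T : bool := [&& is_subgraph T, connected T & acyclic T].

Definition S_tree S T : bool := is_tree T && (S \subset VG T).

(* Packings are sets rather than indexed families of trees: for 1 < #|S| every
   tree connecting S has an edge, so edge-disjoint trees are distinct. *)
Definition tree_packing S F : bool :=
  [forall T in F, S_tree S T] &&
  [forall T1 in F, forall T2 in F, (T1 != T2) ==>
     [disjoint EG T1 & EG T2] && (VG T1 :&: VG T2 == S)].

Definition kappa S : nat := \max_(F | tree_packing S F) #|F|.

End Subgraphs.

(* The neutral value is the maximum over the same range, so that this is the
   true minimum as soon as G has three vertices (and 0 otherwise). *)
Definition kappa3 (G : sgraph) : nat :=
  \big[minn / \max_(S : {set G} | #|S| == 3) kappa S]_(S : {set G} | #|S| == 3)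
    kappa S.

Lemma kappa3_le (G : sgraph) (S : {set G}) : #|S| = 3 -> kappa3 G <= kappa S.
Proof.
move/eqP=> S3; have : S \in index_enum {set G} by rewrite mem_index_enum.
rewrite /kappa3; move: (\max_(_ | _) _) => m.
elim: (index_enum _) => //= T r IHr; rewrite inE big_cons.
case/predU1P=> [<- | /IHr le_r]; first by rewrite S3 geq_minl.
by case: ifP => // _; rewrite geq_min le_r orbT.
Qed.

Lemma kappa3_attained (G : sgraph) :
  2 < #|G| -> exists2 S : {set G}, #|S| = 3 & kappa3 G = kappa S.
Proof.
move=> G3; pose P (S : {set G}) := #|S| == 3.
have [S0 PS0] : exists S0, P S0.
  exists [set x in take 3 (enum G)]; rewrite /P cardsE.
  rewrite (card_uniqP (take_uniq _ (enum_uniq G))) size_takel //.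
  by rewrite -cardE.
have hmax : exists2 S : {set G}, P S & \max_(S | P S) kappa S = kappa S.
  have P_gt0 : 0 < #|P| by apply/card_gt0P; exists S0.
  by have [S PS ?] := eq_bigmax_cond (@kappa G) P_gt0; exists S.
rewrite /kappa3; suff [S /eqP S3 ?] : exists2 S : {set G}, P S &
  \big[minn / \max_(S : {set G} | P S) kappa S]_(S : {set G} | P S) kappa S
    = kappa S by exists S.
apply: (big_ind (fun m => exists2 S : {set G}, P S & m = kappa S)) => //.
- move=> _ _ [S1 P1 ->] [S2 P2 ->].
  by case: (leqP (kappa S1) (kappa S2)) => _; [exists S1 | exists S2].
- by move=> S PS; exists S.
Qed.

(* Symbols and positions are 0-based: 'I_n stands for [n], 'I_k for [k]. *)
Definition arrangement (n k : nat) : finType := {t : k.-tuple 'I_n | uniq t}.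

Section BubbleSort.
Variables n k : nat.
Implicit Types u v : arrangement n k.

Definition letter u (i : 'I_k) : 'I_n := tnth (val u) i.

Definition swap_adj : rel (arrangement n k) := [rel u v |
  [exists i : 'I_k, exists j : 'I_k,
     [&& val j == (val i).+1, letter u i == letter v j,
         letter u j == letter v i &
         [forall l, (l != i) && (l != j) ==> (letter u l == letter v l)]]]].

Definition first_adj : rel (arrangement n k) := [rel u v |
  [forall i : 'I_k, (val i != 0) ==> (letter u i == letter v i)] &&
  [exists i : 'I_k, (val i == 0) && (letter u i != letter v i)]].

Definition bubble_adj : rel (arrangement n k) :=
  [rel u v | swap_adj u v || first_adj u v].

Lemma bubble_adj_sym : symmetric bubble_adj.
Proof.
have hs u v : swap_adj u v -> swap_adj v u.
  case/existsP=> i /existsP[j /and4P[ij /eqP h1 /eqP h2 /forallP h3]].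
  apply/existsP; exists i; apply/existsP; exists j.
  rewrite ij h1 h2 !eqxx; apply/forallP=> l.
  by rewrite [letter v l == _]eq_sym h3.
have hf u v : first_adj u v -> first_adj v u.
  case/andP=> /forallP h1 /existsP[i h2]; apply/andP; split.
    by apply/forallP=> l; rewrite [letter v l == _]eq_sym h1.
  by apply/existsP; exists i; rewrite [letter v i == _]eq_sym.
by move=> u v; apply/idP/idP=> /orP[/hs|/hf] h; apply/orP; [left|right|left|right].
Qed.

Lemma bubble_adj_irr : irreflexive bubble_adj.
Proof.
move=> u; apply/negP=> /orP[|/andP[_ /existsP[i]]]; last by rewrite eqxx andbF.
case/existsP=> i /existsP[j /and4P[/eqP ij /eqP h _ _]].
have /tuple_uniqP inj := valP u.
by move: ij; rewrite (inj _ _ h) => /n_Sn.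
Qed.

Definition bubble_sort_graph : sgraph := SGraph bubble_adj_sym bubble_adj_irr.

End BubbleSort.

(* Main.v *)
Require Import Defs.
From mathcomp Require Import all_boot.

Set Implicit Arguments.
Unset Strict Implicit.
Unset Printing Implicit Defensive.

(** Group the vertices [(a, b)] of the graph by their second letter.  The group
    of [b] is a clique [K_b] on [n - 1] vertices, and the vertex [(a, b)] has
    exactly one neighbour outside of it, namely [(b, a)] in [K_a]: between any
    two cliques there is exactly one edge, and the graph is [(n - 1)]-regular.

    Upper bound ([kappa_le_adj]).  Let [x] and [y] be adjacent vertices of
    degree [d], and [z] a third vertex.  The trees of a packing are
    edge-disjoint and each of them uses an edge at [x] and an edge at [y], so
    there are at most [d] of them.  If there were [d], all edges at [x] and at
    [y] would be used, one per tree; the tree that uses the edge [xy] would then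
    have no other edge at [x] or [y] and could not reach [z].

    Lower bound.  Instead of trees it is enough to exhibit connected subgraphs
    on vertex sets [S :|: W i] ([kappa_ge]): spanning trees do the rest, and they
    are edge-disjoint as soon as the sets [W i] meet only in [S] and at most one
    of the subgraphs uses edges inside [S].  The index [i] ranges over all
    letters but two, and the choice of [W i] depends on how [S] is spread over
    the cliques.
    - [S = {(p,b), (q,b), (r,b)}]: a single vertex [(d,b)] for each
      [d] other than [p], [q], [r], [b]; nothing, with the edges inside [S];
      and everything outside [K_b].  This is [kappa_one_clique].
    - [S = {(p,b), (q,b), (r,c)}]: for each [d] other than [b] and [q], the path
      [(d,b), (b,d), (c,d), (d,c)] that leads from [K_b] to [K_c] through [K_d];
      edges inside [S] are used for [d = p].  This is [kappa_two_cliques].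
    - [S] meets [K_a], [K_b] and [K_c] once each: for each [d] other than [a]
      and [b], the triangle [(a,d), (b,d), (c,d)] of [K_d] with its three
      outgoing edges; edges inside [S] are used for [d = c].  This is
      [kappa_three_cliques]. *)

(** * Spanning trees *)

Section Packings.
Variable G : sgraph.
Implicit Types (S : {set G}) (T : subgraph G) (F : {set subgraph G})
  (x y z u v : G).

Lemma mem_edges x y : ([set x; y] \in edges G) = adj x y.
Proof.
apply/imsetP/idP => [[[a b] ab /= exy]|xy]; last by exists (x, y); rewrite ?inE.
have aNb : a != b by apply/eqP => eab; move: ab; rewrite inE eab adj_irr.
have /set2P ax : a \in [set x; y] by rewrite exy set21.
have /set2P bx : b \in [set x; y] by rewrite exy set22.
move: ab; rewrite inE /=.
case: ax bx => -> [] eb; rewrite eb ?adj_irr //.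
by rewrite adj_sym.
Qed.

Lemma subadj_sym T : symmetric (subadj T).
Proof. by move=> x y; rewrite /subadj /= setUC. Qed.

Lemma connectedI T r :
  r \in VG T -> {in VG T, forall v, connect (subadj T) r v} -> connected T.
Proof.
move=> rT conn; apply/andP; split; first by apply/set0Pn; exists r.
apply/forall_inP => x xT; apply/forall_inP => y yT.
by apply: connect_trans (conn _ yT); rewrite sym_connect_sym ?conn //; apply: subadj_sym.
Qed.

Lemma connectedP T x y :
  connected T -> x \in VG T -> y \in VG T -> connect (subadj T) x y.
Proof. by case/andP=> _ /forall_inP conn xT yT; apply: (forall_inP (conn x xT)). Qed.

Lemma is_subgraph_sub T (E : {set {set G}}) :
  is_subgraph T -> E \subset EG T -> is_subgraph (VG T, E).
Proof.
case/andP=> TG /forall_inP TV ET; apply/andP; split; first exact: subset_trans TG.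
by apply/forall_inP => e eE; apply: TV; apply: (subsetP ET).
Qed.

Lemma subadjD1 (V : {set G}) (E : {set {set G}}) e x y :
  subadj (V, E :\ e) x y = ([set x; y] != e) && ([set x; y] \in E).
Proof. by rewrite /subadj /= in_setD1. Qed.

(** The rest of the cycle still joins the two ends of the deleted edge. *)
Lemma connected_cycleD T x y z c :
  connected T -> ucycle (subadj T) [:: x, y, z & c] ->
  connected (VG T, EG T :\ [set x; y]).
Proof.
move=> conT; set T' := (_, _).
rewrite /ucycle /= rcons_path !inE !negb_or.
case/andP=> /and4P[xy yz zc cx] /and4P[/and3P[xNy xNz xNc] /andP[yNz yNc] zNc uc].
(* Away from y nothing changes, and the remaining part of the cycle, from z to
   x, avoids y. *)
have keep u v : subadj T u v -> u != y -> v != y -> subadj T' u v.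
  move=> uv uNy vNy; rewrite subadjD1; apply/andP; split; last exact: uv.
  apply/eqP => e; have : y \in [set u; v] by rewrite e set22.
  by rewrite !inE ![y == _]eq_sym (negPf uNy) (negPf vNy).
have yz' : subadj T' y z.
  rewrite subadjD1; apply/andP; split; last exact: yz.
  apply/eqP => e; have : z \in [set x; y] by rewrite -e set22.
  by rewrite !inE ![z == _]eq_sym (negPf xNz) (negPf yNz).
have zx' : connect (subadj T') z x.
  apply/connectP; exists (rcons c x); last by rewrite last_rcons.
  have noty : all (predC1 y) (z :: rcons c x).
    rewrite /= all_rcons /= xNy eq_sym yNz /=; apply/allP => u uc' /=.
    by apply: contraNneq yNc => <-.
  apply: (sub_in_path (P := predC1 y) (e := subadj T)) noty _ => [u v uNy vNy uv|].
    exact: keep.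
  by rewrite rcons_path zc.
have sym' := sym_connect_sym (subadj_sym T').
have yx' : connect (subadj T') y x := connect_trans (connect1 yz') zx'.
have [r rT] : exists r, r \in VG T by apply/set0Pn; case/andP: conT.
apply: (connectedI (r := r)) => // v vT.
have := connectedP conT rT vT; apply: connect_sub => u w uw.
have [e | ne] := eqVneq [set u; w] [set x; y]; last first.
  by apply: connect1; rewrite subadjD1 ne; exact: uw.
have /set2P ux : u \in [set x; y] by rewrite -e set21.
have /set2P wx : w \in [set x; y] by rewrite -e set22.
by case: ux wx => -> [] ->; rewrite ?connect0 // sym'.
Qed.

(** Deleting an edge from a cycle preserves connectedness, so a connected
    subgraph with fewest edges is acyclic. *)
Lemma spanning_tree T :
  is_subgraph T -> connected T ->
  exists2 T', is_tree T' & VG T' = VG T /\ EG T' \subset EG T.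
Proof.
have [m] := ubnP #|EG T|; elim: m T => // m IHm T; rewrite ltnS => leT subT conT.
have [acT | ] := boolP (acyclic T); first by exists T; rewrite ?subxx //; apply/and3P.
case/forallPn => k /forallPn[c]; rewrite negb_imply => /andP[].
case: c => -[|x [|y [|z c]]] /= szc cyc; rewrite -?(eqP szc) //= => _.
have xyT : [set x; y] \in EG T by case/andP: cyc => /andP[].
have [|||T' treeT' [VT' ET']] := IHm (VG T, EG T :\ [set x; y]).
- by apply: leq_trans leT; rewrite [ltnRHS](cardsD1 [set x; y]) xyT.
- by apply: is_subgraph_sub; rewrite ?subsetDl.
- exact: connected_cycleD cyc.
by exists T' => //; split=> //; apply: subset_trans ET' (subsetDl _ _).
Qed.

Lemma tree_edge T x z : is_tree T -> x \in VG T -> z \in VG T -> x != z ->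
  exists v, [set x; v] \in EG T.
Proof.
move=> /and3P[_ conT _] xT zT xNz.
have /connectP[[|v p] /= ] := connectedP conT xT zT.
  by move=> _ e; rewrite e eqxx in xNz.
by case/andP=> xv _ _; exists v.
Qed.

(** * Packings of trees *)

(** The flag [b] tells whether edges with both ends in [S] may be used: in a
    packing only one tree is granted them. *)
Definition link S (W : {set G}) (b : bool) : rel G :=
  [rel u v | [&& adj u v, u \in S :|: W, v \in S :|: W &
                 b || ~~ ((u \in S) && (v \in S))]].

Definition connector S W b :=
  exists2 r, r \in S :|: W & {in S :|: W, forall v, connect (link S W b) r v}.

(** An edge shared by two of the subgraphs has both ends in [S], because the
    sets [W i] meet only there; but only the subgraph of index [i0] has such
    edges.  Trees of different indices are different because they have at least
    one edge and no common edge. *)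
Lemma kappa_ge S (I : finType) (A : {set I}) (W : I -> {set G}) (i0 : I) :
  1 < #|S| ->
  {in A, forall i, connector S (W i) (i == i0)} ->
  {in A &, forall i j, i != j -> W i :&: W j \subset S} ->
  #|A| <= kappa S.
Proof.
move=> S2 conn disj.
pose E i := [set e in edges G |
  (e \subset S :|: W i) && ((i == i0) || ~~ (e \subset S))].
(* A dummy value outside A makes the choice of the trees a total function. *)
have tree i : exists T, i \in A ->
    [/\ is_tree T, VG T = S :|: W i & EG T \subset E i].
  have [iA|] := boolP (i \in A); last by exists (set0, set0).
  have [r rW rconn] := conn i iA.
  have subE u v : subadj (S :|: W i, E i) u v = link S (W i) (i == i0) u v.
    rewrite /subadj /link /E /= inE mem_edges.
    by rewrite !subUset !sub1set -!andbA.
  have [|| T treeT [VT ET]] := @spanning_tree (S :|: W i, E i).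
  - apply/andP; split; first by apply/subsetP => e; rewrite inE => /andP[].
    by apply/forall_inP => e; rewrite inE => /and3P[].
  - apply: (connectedI (r := r)) => // v vW.
    by rewrite (eq_connect subE) rconn.
  by exists T.
have /fin_all_exists[T TP] := tree.
have edisj i j : i \in A -> j \in A -> i != j -> [disjoint EG (T i) & EG (T j)].
  move=> iA jA ij; have [_ _ Ei] := TP i iA; have [_ _ Ej] := TP j jA.
  apply/pred0Pn => -[e /andP[/(subsetP Ei) ei /(subsetP Ej) ej]].
  move: ei ej; rewrite !inE => /and3P[_ eWi Si] /and3P[_ eWj Sj].
  have eS : e \subset S.
    apply/subsetP => u ue; have := subsetP eWi _ ue; have := subsetP eWj _ ue.
    rewrite !inE => /orP[//|uj] /orP[//|ui].
    by apply: (subsetP (disj _ _ iA jA ij)); rewrite inE ui.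
  move: Si Sj; rewrite eS !orbF => /eqP ei0 /eqP ej0.
  by rewrite ei0 ej0 eqxx in ij.
have Tinj : {in A &, injective T}.
  move=> i j iA jA eT; apply/eqP/negPn/negP => /(edisj _ _ iA jA).
  rewrite -eT -setI_eq0 setIid.
  have [x [z [xS zS xNz]]] := card_gt1P S2.
  have [treeT VT _] := TP i iA.
  have [||v ev] := tree_edge treeT _ _ xNz; rewrite ?VT ?inE ?xS ?zS //.
  by apply/negP/set0Pn; exists [set x; v].
rewrite -(card_in_imset Tinj).
apply: (@leq_bigmax_cond _ (@tree_packing G S) (fun F => #|F|)).
apply/andP; split.
  apply/forall_inP => _ /imsetP[i iA ->]; have [treeT VT _] := TP i iA.
  by rewrite /S_tree treeT VT subsetUl.
apply/forall_inP => _ /imsetP[i iA ->]; apply/forall_inP => _ /imsetP[j jA ->].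
apply/implyP => TiTj.
have ij : i != j by apply: contraNneq TiTj => ->.
rewrite edisj //=; have [_ -> _] := TP i iA; have [_ -> _] := TP j jA.
by rewrite -setUIr (setUidPl _) // disj.
Qed.

(** Choosing in each tree an edge at [x] other than [xw] gives an injection of
    the packing into the neighbours of [x] other than [w]. *)
Lemma packing_card S F x w : tree_packing S F -> adj x w ->
  {in F, forall T, exists2 v, v != w & [set x; v] \in EG T} ->
  #|F| <= #|[set v | adj x v]|.-1.
Proof.
case/andP=> /forall_inP treeF /forall_inP disjF xw edgeF.
have edge T : exists v, T \in F -> v != w /\ [set x; v] \in EG T.
  have [/edgeF[v]|] := boolP (T \in F); first by exists v.
  by exists x.
have /fin_all_exists[f fP] := edge.
have finj : {in F &, injective f}.
  move=> T1 T2 F1 F2 ef; apply/eqP/negPn/negP => T12.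
  have /andP[/pred0P/(_ [set x; f T1]) /= + _] :=
    implyP (forall_inP (disjF _ F1) _ F2) T12.
  by rewrite (proj2 (fP _ F1)) ef (proj2 (fP _ F2)).
rewrite -(card_in_imset finj) (cardsD1 w [set v | adj x v]) inE xw /=.
apply: subset_leq_card; apply/subsetP => _ /imsetP[T TF ->].
have [fNw fT] := fP T TF; rewrite !inE fNw -mem_edges.
by have /andP[/and3P[/andP[/subsetP TG _] _ _] _] := treeF T TF; apply: TG.
Qed.

(** Either every tree has an edge at [x] other than [xy], or some tree has
    [xy] as its only edge at [x].  In the second case that tree must leave
    [{x, y}] at [y] in order to reach [z], and the other trees do not contain
    [xy], so every tree has an edge at [y] other than [yx].  In both cases
    [packing_card] applies. *)
Lemma kappa_le_adj x y z d :
  adj x y -> x != z -> y != z ->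
  #|[set v | adj x v]| <= d -> #|[set v | adj y v]| <= d ->
  kappa [set x; y; z] <= d.-1.
Proof.
move=> xy xNz yNz dx dy; apply/bigmax_leqP => F packF.
have /andP[/forall_inP treeF /forall_inP disjF] := packF.
have SF T : T \in F -> [/\ is_tree T, x \in VG T, y \in VG T & z \in VG T].
  by move=> /treeF/andP[treeT /subsetP ST]; split=> //; apply: ST; rewrite !inE eqxx ?orbT.
case: (boolP [forall T in F, [exists v, (v != y) && ([set x; v] \in EG T)]]).
  move/forall_inP => allx.
  apply: leq_trans (packing_card packF xy _) _; last by rewrite -!subn1 leq_sub2r.
  by move=> T /allx/existsP[v /andP[]]; exists v.
case/forall_inPn => T0 T0F /existsPn noTx.
apply: leq_trans (packing_card (x := y) (w := x) packF _ _) _; first by rewrite adj_sym.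
  2: by rewrite -!subn1 leq_sub2r.
have onlyy v : [set x; v] \in EG T0 -> v = y.
  by move=> xv; apply/eqP; have := noTx v; rewrite xv andbT negbK.
have [tree0 xT0 yT0 zT0] := SF _ T0F.
have xyT0 : [set x; y] \in EG T0.
  by have [v xv] := tree_edge tree0 xT0 zT0 xNz; rewrite -(onlyy _ xv).
move=> T TF; have [eT|neT] := eqVneq T T0; last first.
  have [treeT xT yT zT] := SF _ TF.
  have [v yv] := tree_edge treeT yT zT yNz; exists v => //.
  apply: contraTneq yv => ->; rewrite setUC.
  have /andP[dTT _] := implyP (forall_inP (disjF _ TF) _ T0F) neT.
  by apply/negP => xyT; have /pred0P/(_ [set x; y]) /= := dTT; rewrite xyT xyT0.
rewrite {}eT; case: (boolP [exists v, (v != x) && ([set y; v] \in EG T0)]).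
  by case/existsP => v /andP[]; exists v.
move/existsPn => noTy.
have clos : closed (subadj T0) (mem [set x; y]).
  apply: intro_closed; first exact: sym_connect_sym (subadj_sym T0).
  move=> u v uv; rewrite !inE => /orP[]/eqP eu; rewrite eu in uv.
    by rewrite (onlyy v uv) eqxx orbT.
  by have := noTy v; rewrite [_ \in EG T0]uv andbT negbK => ->.
have := closed_connect clos (connectedP (y := z) _ xT0 zT0).
case/and3P: tree0 => _ -> _ /(_ isT).
by rewrite !inE eqxx ![z == _]eq_sym (negPf xNz) (negPf yNz).
Qed.

End Packings.

(** * The structure of the graph *)

Section BubbleSortTwo.
Variable n : nat.
Notation G := (bubble_sort_graph n 2).
Implicit Types a b c d p q r : 'I_n.
Implicit Types S W : {set G}.

Lemma uniq_pair a b : a != b -> uniq [tuple a; b].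
Proof. by rewrite /= inE andbT. Qed.

Definition vtx a b (ab : a != b) : G := exist _ [tuple a; b] (uniq_pair ab).

Variant vtx_spec : G -> Type := VtxSpec a b (ab : a != b) : vtx_spec (vtx ab).

Lemma vtxP (u : G) : vtx_spec u.
Proof.
have ab : letter u ord0 != letter u ord_max.
  by apply/eqP => /(tuple_uniqP _ (valP u)).
suff -> : u = vtx ab by [].
apply/val_inj/eq_from_tnth => i.
case: i => -[|[|//]] i; rewrite /letter /tnth /=.
 all: by case: (val u) => -[|? []].
Qed.

Lemma vtx_eq a b (ab : a != b) c d (cd : c != d) :
  (vtx ab == vtx cd) = (a == c) && (b == d).
Proof. by rewrite -val_eqE /= -val_eqE /= !eqseq_cons andbT. Qed.

Lemma vtx_adj a b (ab : a != b) c d (cd : c != d) :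
  adj (vtx ab) (vtx cd) = (b == d) && (a != c) || (a == d) && (b == c).
Proof.
have l0 x y (xy : x != y) : letter (vtx xy) ord0 = x by [].
have l1 x y (xy : x != y) : letter (vtx xy) ord_max = y by [].
have ordI2 (i : 'I_2) : i = if val i == 0 then ord0 else ord_max.
  by apply: val_inj; case: i => -[|[|]].
rewrite orbC; congr orb.
  apply/existsP/andP.
    case=> i /existsP[j /and4P[/eqP ij ai bj _]].
    move: ai bj; rewrite (ordI2 i) (ordI2 j) ij.
    by case: i j ij => -[|[|//]] i [[|[|//]] j].
  case=> ad bc; exists ord0; apply/existsP; exists ord_max.
  rewrite !l0 !l1 ad bc eqxx /=.
  by apply/forallP => l; rewrite (ordI2 l); case: ifP.
apply/andP/andP => [[/forallP bd /existsP[i /andP[i0]]]|[bd ac]].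
  by rewrite (ordI2 i) i0 l0; split; first have := bd ord_max.
split; last by apply/existsP; exists ord0; rewrite !l0.
by apply/forallP => i; rewrite (ordI2 i); case: ifP; rewrite // !l1 bd implybT.
Qed.

(** The first letters of the neighbours of [(a, b)] are pairwise distinct, and
    different from [a]: those of the clique of [b] have every first letter but
    [a] and [b], and [(b, a)] has [b]. *)
Lemma degree_le (u : G) : #|[set v | adj u v]| <= n.-1.
Proof.
case: (vtxP u) => a b ab.
pose first (v : G) := letter v ord0.
have fE c d (cd : c != d) : first (vtx cd) = c.
  by rewrite /first /letter (tnth_nth c).
have finj : {in [set v | adj (vtx ab) v] &, injective first}.
  move=> v w; case: (vtxP v) => c d cd; case: (vtxP w) => c' d' cd'.
  rewrite !inE !vtx_adj !fE => Hv Hw e; apply/eqP; rewrite vtx_eq e eqxx /=.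
  move: Hv Hw cd cd'; rewrite e => /orP[]/andP[/eqP <- h] /orP[]/andP[/eqP <- h'] //.
    by rewrite (eqP h') eqxx.
  by rewrite (eqP h) => _; rewrite eqxx.
rewrite -(card_in_imset finj) -[X in X.-1]card_ord -cardsT (cardsD1 a setT) inE.
apply: subset_leq_card; apply/subsetP => _ /imsetP[v + ->].
case: (vtxP v) => c d cd; rewrite !inE vtx_adj fE andbT => /orP[]/andP[].
  by rewrite [c == a]eq_sym.
by move=> _ /eqP <-; rewrite eq_sym.
Qed.

Lemma letter0_vtx a b (ab : a != b) : letter (vtx ab) ord0 = a.
Proof. by []. Qed.

Lemma letter1_vtx a b (ab : a != b) : letter (vtx ab) ord_max = b.
Proof. by []. Qed.

(** * Walks along letters *)

Definition letters (u : G) := (letter u ord0, letter u ord_max).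

Lemma linkE S W s (u v : G) : link S W s u v =
  [&& adj u v, u \in S :|: W, v \in S :|: W & s || ~~ ((u \in S) && (v \in S))].
Proof. by []. Qed.

(** Quantifying over the proof of [a != b] lets a walk be described by letters
    only, and makes the statement hold vacuously for the non-vertex [(a, a)]. *)
Definition reach (e : rel G) u a b := forall ab : a != b, connect e u (vtx ab).

Lemma reach_refl e a b (ab : a != b) : reach e (vtx ab) a b.
Proof. by move=> ab'; rewrite (eq_irrelevance ab' ab). Qed.

Lemma reach_step e u a b c d (ab : a != b) : reach e u a b ->
  (forall cd : c != d, (vtx ab == vtx cd) || e (vtx ab) (vtx cd)) -> reach e u c d.
Proof.
move=> uab step cd; apply: connect_trans (uab ab) _.
by have /predU1P[-> //|] := step cd; apply: connect1.
Qed.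

Arguments reach_step {e u a b c d} ab.

Lemma connector_reach S W s p b (pb : p != b) : vtx pb \in S ->
  (forall i j (ij : i != j), vtx ij \in S :|: W -> reach (link S W s) (vtx pb) i j) ->
  connector S W s.
Proof.
move=> xS conn; exists (vtx pb); first by rewrite inE xS.
by move=> v; case: (vtxP v) => i j ij vSW; apply: conn.
Qed.

(** Proves a boolean combination of equalities between letters by splitting on
    those that the disequalities in the context do not settle. *)
Ltac decide_letters :=
  repeat match goal with
  | H : is_true (?a != ?a) |- _ => by rewrite eqxx in H
  | |- context [?a == ?a] => rewrite eqxx
  | H : is_true (?a != ?b) |- context [?a == ?b] => rewrite (negPf H)
  | H : is_true (?a != ?b) |- context [?b == ?a] => rewrite [b == a]eq_sym (negPf H)
  end; rewrite ?andbT ?orbT ?andbF ?orbF //=;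
  try match goal with
  | |- context [?a == ?b] =>
    let e := fresh "e" in case: (eqVneq a b) => [e|e]; [subst | ]; decide_letters
  end.

(** Turns adjacency and membership in explicit sets of vertices into equalities
    between letters. *)
Ltac expand_letters :=
  rewrite ?linkE ?vtx_adj ?inE ?vtx_eq ?xpair_eqE ?letter0_vtx ?letter1_vtx.

(** Extends a walk by one vertex, which may also coincide with the last one. *)
Ltac step H :=
  apply: (reach_step _ H) => //; try (move=> ?; expand_letters; decide_letters).

(** Splits the membership of a vertex in an explicit set into one goal for each
    member. *)
Ltac case_letters :=
  expand_letters;
  repeat match goal with |- is_true (_ || _) -> _ => case/orP end;
  try done; case/andP=> /eqP-> /eqP->.

(** * Packings for three vertices of the graph *)

Lemma card_compl2 a b : a != b -> #|~: [set a; b]| = n - 2.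
Proof. by move=> ab; rewrite cardsCs setCK card_ord cards2 ab. Qed.

Lemma card_triple (x y z : G) : x != y -> 1 < #|[set x; y; z]|.
Proof. by move=> xy; apply/card_gt1P; exists x, y; rewrite !inE !eqxx orbT. Qed.

(** The two indices [q] and [r] carry the exceptional subgraphs: the edges
    inside [S], and the graph outside the clique of [b]. *)
Lemma kappa_one_clique p q r b (pb : p != b) (qb : q != b) (rb : r != b) :
  p != q -> q != r -> r != p -> n - 2 <= kappa [set vtx pb; vtx qb; vtx rb].
Proof.
move=> pq qr rp; have bp : b != p by rewrite eq_sym.
rewrite -(card_compl2 bp).
pose W d := if d == q then set0 else
  if d == r then [set v : G | letter v ord_max != b]
  else [set v | letters v == (d, b)].
apply: (kappa_ge (W := W) (i0 := q)) => [|d|d d'].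
- by apply: card_triple; expand_letters; decide_letters.
- rewrite !inE negb_or => /andP[db dp]; apply: (connector_reach (pb := pb)).
    by rewrite !inE eqxx.
  pose R T s := reach (link [set vtx pb; vtx qb; vtx rb] T s) (vtx pb).
  have Rx T s : R T s p b by apply: reach_refl.
  rewrite /W; have [dq|dq] := eqVneq d q.
    by move=> i j ij; case_letters => //; step (Rx set0 true).
  have [dr|dr] := eqVneq d r; last first.
    set V := finset _; have Rd : R V false d b by step (Rx V false).
    by move=> i j ij; case_letters => //; step Rd.
  set V := finset _.
  have Rp : R V false b p by step (Rx V false).
  (* In the outside, every clique is entered from the clique of p. *)
  have Rout k l : l != b -> R V false k l.
    move=> lb; have [->|lp] := eqVneq l p; first by step Rp.
    have Rlp : R V false l p by step Rp.
    have pl : p != l by rewrite eq_sym.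
    have Rpl : R V false p l by step Rlp.
    by step Rpl.
  have bq : b != q by rewrite eq_sym.
  have br : b != r by rewrite eq_sym.
  have Rq : R V false q b by step (Rout b q qb).
  have Rr : R V false r b by step (Rout b r rb).
  move=> i j ij; expand_letters => /orP[|jb]; last exact: Rout.
  by case/orP=> [/orP[]|] /andP[/eqP-> /eqP->] //; apply: Rx.
- rewrite !inE !negb_or => /andP[db dp] /andP[d'b d'p] dd'.
  apply/subsetP => v; case: (vtxP v) => i j ij; rewrite /W.
  by do 4?[case: ifP => [/eqP ?|/negbT ?]]; subst; expand_letters; decide_letters.
Qed.

(** The path of index [d] may meet [S]: it starts in [(p,b)] when [d = p],
    and ends in [(r,c)] when [d = r].  For [d = c] it reduces to [(c,b), (b,c)].
    The index [q] is left out because its path starts in the other vertex of the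
    clique of [b]; the path of index [p] reaches that vertex by the edge inside
    [S]. *)
Lemma kappa_two_cliques p q b r c (pb : p != b) (qb : q != b) (rc : r != c) :
  p != q -> b != c -> n - 2 <= kappa [set vtx pb; vtx qb; vtx rc].
Proof.
move=> pq bc; have bq : b != q by rewrite eq_sym.
rewrite -(card_compl2 bq).
pose W d := [set v | letters v \in [:: (d, b); (b, d); (c, d); (d, c)]].
apply: (kappa_ge (W := W) (i0 := p)) => [|d|d d'].
- by apply: card_triple; expand_letters; decide_letters.
- rewrite !inE negb_or => /andP[db dq]; apply: (connector_reach (pb := pb)).
    by rewrite !inE eqxx.
  pose R := reach (link [set vtx pb; vtx qb; vtx rc] (W d) (d == p)) (vtx pb).
  have bd : b != d by rewrite eq_sym.
  have Rx : R p b by apply: reach_refl.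
  have R1 : R d b by step Rx.
  have R2 : R b d by step R1.
  have R3 : d != c -> R c d by move=> dc; step R2.
  have R4 : d != c -> R d c.
    move=> dc; have cd : c != d by rewrite eq_sym.
    by step (R3 dc).
  have Ry : R q b by step R1.
  have Rz : R r c.
    have [dc|dc] := eqVneq d c; last by step (R4 dc).
    by move: R2; rewrite /R dc => R2; step R2.
  have R3' : R c d by move=> cd; apply: (R3 _ cd); rewrite eq_sym.
  have R4' : R d c by move=> dc; apply: (R4 dc dc).
  by move=> i j ij; case_letters.
- rewrite !inE !negb_or => /andP[db dq] /andP[d'b d'q] dd'.
  by apply/subsetP => v; case: (vtxP v) => i j ij; expand_letters; decide_letters.
Qed.

(** For [d = c] the set [W d] consists of [(c,a)], [(a,c)], [(b,c)], [(c,b)],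
    which is a path from the clique of [a] to the clique of [b] through the
    clique of [c]. *)
Lemma kappa_three_cliques p a q b r c (pa : p != a) (qb : q != b) (rc : r != c) :
  a != b -> b != c -> c != a -> n - 2 <= kappa [set vtx pa; vtx qb; vtx rc].
Proof.
move=> ab bc ca; rewrite -(card_compl2 ab).
pose W d := [set v | letters v \in
  [:: (d, a); (d, b); (d, c); (a, d); (b, d); (c, d)]].
apply: (kappa_ge (W := W) (i0 := c)) => [|d|d d'].
- by apply: card_triple; expand_letters; decide_letters.
- rewrite !inE negb_or => /andP[da db]; apply: (connector_reach (pb := pa)).
    by rewrite !inE eqxx.
  pose R := reach (link [set vtx pa; vtx qb; vtx rc] (W d) (d == c)) (vtx pa).
  have ad : a != d by rewrite eq_sym.
  have ac : a != c by rewrite eq_sym.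
  have bd : b != d by rewrite eq_sym.
  have Rx : R p a by apply: reach_refl.
  have R1 : R d a by step Rx.
  have R2 : R a d by step R1.
  have R3 : R b d by step R2.
  have R4 : R c d by step R2.
  have R5 : R d b by step R3.
  have R6 : d != c -> R d c.
    move=> dc; have cd : c != d by rewrite eq_sym.
    by step R4.
  have Ry : R q b by step R5.
  have Rz : R r c.
    have [dc|dc] := eqVneq d c; last by step (R6 dc).
    by move: R2; rewrite /R dc => R2; step R2.
  have R6' : R d c by move=> dc; apply: (R6 dc dc).
  by move=> i j ij; case_letters.
- rewrite !inE !negb_or => /andP[da db] /andP[d'a d'b] dd'.
  by apply/subsetP => v; case: (vtxP v) => i j ij; expand_letters; decide_letters.
Qed.

(** When exactly two of the three vertices lie in one clique, permuting them puts
    these two first. *)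
Lemma kappa_bubble_ge (S : {set G}) : #|S| = 3 -> n - 2 <= kappa S.
Proof.
move=> S3; have /card_gt2P[x [y [z [[xS yS zS] [xy yz zx]]]]] : 2 < #|S| by rewrite S3.
have -> : S = [set x; y; z].
  apply/esym/eqP; rewrite eqEcard S3 !subUset !sub1set xS yS zS /=.
  by rewrite -setUA cardsU1 cards2 !inE negb_or xy [x == z]eq_sym zx yz.
case: (vtxP x) xy zx => p a pa; case: (vtxP y) yz => q b qb; case: (vtxP z) => r c rc.
rewrite !vtx_eq => {x y z xS yS zS}.
have [eab|ab] := eqVneq a b.
  subst b; rewrite andbT => qr pq rp.
  have [eac|ac] := eqVneq a c; last exact: kappa_two_cliques.
  by subst c; rewrite eqxx !andbT in qr rp; apply: kappa_one_clique.
have [ebc|bc] := eqVneq b c.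
  subst c; rewrite !andbT -setUA setUC => qr _ _.
  by apply: kappa_two_cliques; rewrite // eq_sym.
have [eca|ca] := eqVneq c a; last by move=> _ _ _; apply: kappa_three_cliques.
subst c; rewrite andbT setUAC => _ _ rp.
by apply: kappa_two_cliques; rewrite // eq_sym.
Qed.

Lemma exists_kappa_le : 3 <= n ->
  exists2 S : {set G}, #|S| = 3 & kappa S <= n - 2.
Proof.
rewrite -{1}[n]card_ord => /card_gt2P[a [b [c [_ [ab bc ca]]]]].
have ba : b != a by rewrite eq_sym.
exists [set vtx ba; vtx ca; vtx ab].
  by rewrite -setUA cardsU1 cards2 !inE !vtx_eq; decide_letters.
rewrite subn2; apply: kappa_le_adj; rewrite ?degree_le ?vtx_adj ?vtx_eq //;
  by decide_letters.
Qed.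

End BubbleSortTwo.

Theorem theorem1 (n : nat) (hn : 3 <= n) :
  kappa3 (bubble_sort_graph n 2) = n - 2.
Proof.
have [S0 S03 le_n] := exists_kappa_le hn.
have [S S3 eS] :
  exists2 S : {set bubble_sort_graph n 2},
    #|S| = 3 & kappa3 (bubble_sort_graph n 2) = kappa S.
  by apply: kappa3_attained; rewrite -S03 max_card.
apply/eqP; rewrite eqn_leq (leq_trans (kappa3_le S03) le_n) eS.
exact: kappa_bubble_ge.
Qed.
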